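(* Let $p$ be a prime and let $k \geq 1$ be an integer. Then $$P(\mathbb{Z}_{p^k}) = \frac{(k+1)p - k}{p^{k+1}}.$$
   Context: $\mathbb{Z}_n$ denotes the ring of integers modulo $n$. For a finite ring $R$, $P(R)$ denotes the probability that two elements of $R$ chosen at random (with replacement) have product zero, i.e. $P(R) = \frac{|Ann|}{|R\times R|}$, where $Ann = \{(x,y) \in R\times R : xy = 0\}$. *)

(* Defs.v *)
From mathcomp Require Import all_boot all_order all_algebra.
Set Implicit Arguments.
Unset Strict Implicit.
Unset Printing Implicit Defensive.
Import GRing.Theory.
Local Open Scope ring_scope.

Definition Ann (R : finPzRingType) : {set R * R} :=
  [set xy : R * R | xy.1 * xy.2 == 0].

Definition P (R : finPzRingType) : rat :=
  #|Ann R|%:R / #|[set: R * R]|%:R.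

(* Main.v *)
(** For fixed [x], the [y] in [Z_n] with [x * y = 0] are the multiples of
    [n / gcd(x, n)], so [#|Ann Z_n| = \sum_(x < n) gcd(x, n)].  For [n = p ^ k]
    this sum [S k] satisfies [S k.+1 = p * S k + (p ^ k.+1 - p ^ k)]: the
    multiples of [p] contribute [p * S k] and every other term is 1. *)
Require Import Defs.
From mathcomp Require Import all_boot all_order all_algebra.
From mathcomp Require Import ring.
Set Implicit Arguments.
Unset Strict Implicit.
Unset Printing Implicit Defensive.
Import GRing.Theory.
Local Open Scope ring_scope.

(** By induction on [m]: the block from [m * d] up to [m.+1 * d] contains a single multiple of [d],
    its first element. *)
Lemma sum_multiples (m d : nat) (F : nat -> nat) (d_gt0 : (0 < d)%N) :
  (\sum_(0 <= i < m * d | d %| i) F i = \sum_(0 <= j < m) F (j * d))%N.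
Proof.
elim: m => [|m IHm]; first by rewrite mul0n !big_nil.
rewrite big_nat_recr //= -IHm mulSnr.
rewrite (@big_cat_nat _ _ _ (m * d)) ?leq_addr //=; congr (_ + _)%N.
rewrite big_ltn_cond ?dvdn_mull //;
  last by rewrite -[X in (X < _)%N]addn0 ltn_add2l.
rewrite big_nat_cond big_pred0 ?addn0 // => i; apply/negbTE/negP.
case/andP=> /andP[lt_md_i lt_i] /dvdnP[j def_i].
move: lt_md_i lt_i; rewrite def_i -mulSnr !ltn_pmul2r //.
by move=> lt_mj; rewrite ltnS leqNgt lt_mj.
Qed.

Lemma card_annihilator_gcdn (n x : nat) (n_gt0 : (0 < n)%N) :
  (\sum_(0 <= y < n | n %| x * y) 1 = gcdn x n)%N.
Proof.
have g_gt0 : (0 < gcdn x n)%N by rewrite gcdn_gt0 n_gt0 orbT.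
set g := gcdn x n in g_gt0 *.
have def_n : (n = g * (n %/ g))%N by rewrite mulnC divnK ?dvdn_gcdr.
have q_gt0 : (0 < n %/ g)%N by rewrite divn_gt0 // dvdn_leq ?dvdn_gcdr.
have co_qx : coprime (n %/ g) (x %/ g).
  rewrite /coprime -(eqn_pmul2r g_gt0) muln_gcdl !divnK ?dvdn_gcdl ?dvdn_gcdr //.
  by rewrite mul1n gcdnC.
(* Cancelling [g] turns [n %| x * y] into [n %/ g %| (x %/ g) * y], and Gauss's lemma removes
   [x %/ g]. There are [g] multiples of [n %/ g] below [n]. *)
rewrite (eq_bigl (fun y => n %/ g %| y)%N) => [|y].
  by rewrite [in X in index_iota _ X]def_n sum_multiples //
             sum_nat_const_nat subn0 muln1.
rewrite -(Gauss_dvdr y co_qx) -[RHS](dvdn_pmul2l g_gt0) -def_n mulnA.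
by rewrite [(g * (x %/ g))%N]mulnC divnK ?dvdn_gcdl.
Qed.

Lemma card_Ann_Zp (n : nat) (n_gt1 : (1 < n)%N) :
  #|Ann 'Z_n| = (\sum_(0 <= x < n) gcdn x n)%N.
Proof.
(* With [n.+2] explicit, a zero product in ['Z_n.+2] is divisibility by [n.+2] by computation. *)
case: n n_gt1 => [|[|n]] // _.
rewrite -sum1_card big_mkord.
rewrite (eq_bigl (fun xy : 'Z_n.+2 * 'Z_n.+2 => (n.+2 %| xy.1 * xy.2)%N));
  last by move=> xy; rewrite inE.
rewrite -(pair_big_dep xpredT (fun x y : 'Z_n.+2 => (n.+2 %| x * y)%N)
          (fun _ _ => 1%N)) /=.
by apply: eq_bigr => x _; rewrite -card_annihilator_gcdn // big_mkord.
Qed.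

(** The factor [p] and the term moved to the left avoid both [p ^ k.-1] and truncated subtraction,
    so that the induction can start at [k = 0]. *)
Lemma sum_gcdn_expn (p k : nat) (p_prime : prime p) :
  (p * (\sum_(0 <= x < p ^ k) gcdn x (p ^ k)) + k * p ^ k = k.+1 * p ^ k.+1)%N.
Proof.
have p_gt0 := prime_gt0 p_prime.
elim: k => [|k IHk]; first by rewrite !expn0 big_nat1 /= gcd0n !muln1 addn0 mul1n expn1.
rewrite (bigID (fun x => p %| x)%N) /=.
have -> : (\sum_(0 <= x < p ^ k.+1 | p %| x) gcdn x (p ^ k.+1) =
           p * \sum_(0 <= x < p ^ k) gcdn x (p ^ k))%N.
  rewrite [in X in index_iota _ X]expnSr sum_multiples // big_distrr /=.
  by apply: eq_bigr => j _; rewrite expnSr -muln_gcdl mulnC.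
have -> : (\sum_(0 <= x < p ^ k.+1 | ~~ (p %| x)) gcdn x (p ^ k.+1) =
           \sum_(0 <= x < p ^ k.+1 | ~~ (p %| x)) 1)%N.
  apply: eq_bigr => x ndvd_px; apply/eqP.
  by rewrite -/(coprime _ _) coprimeXr // coprime_sym prime_coprime.
have split1 : (p ^ k + \sum_(0 <= x < p ^ k.+1 | ~~ (p %| x)) 1 = p ^ k.+1)%N.
  rewrite -[RHS]muln1 -{2}[(p ^ k.+1)%N]subn0 -sum_nat_const_nat.
  rewrite [RHS](bigID (fun x => p %| x)%N) /=; congr (_ + _)%N.
  by rewrite expnSr sum_multiples // sum_nat_const_nat subn0 muln1.
move: IHk split1; set S := bigop.body _ _ _; set N := bigop.body _ _ _ => IHk split1.
(* Regrouped to expose the left-hand sides of [IHk] and [split1]. *)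
transitivity (p * (p * S + k * p ^ k) + p * (p ^ k + N))%N.
  by rewrite [(p ^ k.+1)%N]expnS; ring.
by rewrite IHk split1 -!expnS [(p ^ k.+2)%N]expnS; ring.
Qed.

Theorem theorem3p1 (p k : nat) (p_prime : prime p) (k_ge1 : (1 <= k)%N) :
  P 'Z_(p ^ k) = ((k%:R + 1) * p%:R - k%:R) / p%:R ^+ k.+1 :> rat.
Proof.
(* This is where [k_ge1] enters: ['Z_n] has [n] elements only for [n > 1], as ['Z_1] is ['I_2]. *)
have n_gt1 : (1 < p ^ k)%N by rewrite -(exp1n k) ltn_exp2r ?prime_gt1.
rewrite /P cardsT card_prod card_ord Zp_cast // card_Ann_Zp //.
have := congr1 (fun n => n%:R : rat) (sum_gcdn_expn k p_prime).
set S := bigop.body _ _ _.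
have p_neq0 : p%:R != 0 :> rat by rewrite Num.Theory.pnatr_eq0 -lt0n prime_gt0.
have q_neq0 : p%:R ^+ k != 0 :> rat by rewrite expf_neq0.
rewrite natrD !natrM !natrX exprS -natr1 => eqS.
(* [eqS] determines [p * S], not [S] itself. *)
apply: (mulfI p_neq0); rewrite mulrA.
have -> : p%:R * S%:R = (k%:R + 1) * (p%:R * p%:R ^+ k) - k%:R * p%:R ^+ k :> rat.
  by rewrite -eqS addrK.
by field; rewrite p_neq0 q_neq0.
Qed.
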